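(* Let $k\geq 3$ be an integer and $0<\varepsilon<1$ a constant, and set $Q(k,\varepsilon)=(320k^4)^{k+1}/\varepsilon^{2k}$ and $a_k=\binom{k}{2}-k$. If $q\geq Q(k,\varepsilon)$ is an integer and $t$ is an integer with $0\leq t\leq (1-\varepsilon)q$, then \[ r\big(C_4,B^{(k)}_{q^2-kq+t+a_k}\big)\leq q^2+t. \]
   Context: For graphs $H_1,H_2$, the Ramsey number $r(H_1,H_2)$ is the smallest integer $N$ such that for every graph $G$ on $N$ vertices, either $G$ contains $H_1$ as a subgraph or the complement $\overline{G}$ contains $H_2$ as a subgraph. $C_4$ is the cycle on 4 vertices. For positive integers $n,k$, the book graph $B_n^{(k)}$ consists of $n$ copies of $K_{k+1}$ all sharing a common $K_k$. *)

(* Defs.v *)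
From mathcomp Require Import all_boot all_order all_algebra.
From mathcomp Require Import boolp reals.

Set Implicit Arguments.
Unset Strict Implicit.
Unset Printing Implicit Defensive.

Import Order.TTheory GRing.Theory Num.Theory.
Local Open Scope ring_scope.

Record sgraph := SGraph {
  vertex :> finType;
  adj : rel vertex;
  adj_sym : symmetric adj;
  adj_irrefl : irreflexive adj }.

Definition compl_adj (G : sgraph) : rel G := fun x y => (x != y) && ~~ adj x y.

Lemma compl_adj_sym (G : sgraph) : symmetric (@compl_adj G).
Proof. by move=> x y; rewrite /compl_adj eq_sym adj_sym. Qed.

Lemma compl_adj_irrefl (G : sgraph) : irreflexive (@compl_adj G).
Proof. by move=> x; rewrite /compl_adj eqxx. Qed.

Definition complement (G : sgraph) : sgraph :=
  SGraph (@compl_adj_sym G) (@compl_adj_irrefl G).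

(* Subgraphs are not required to be induced. *)
Definition contains (G H : sgraph) : Prop :=
  exists2 f : H -> G, injective f & forall x y, adj x y -> adj (f x) (f y).

Definition ramsey_prop (H1 H2 : sgraph) (N : nat) : Prop :=
  forall G : sgraph, #|G| = N -> contains G H1 \/ contains (complement G) H2.

Lemma ramsey_sets (m n : nat) : exists N : nat,
  forall (G : sgraph) (A : {set G}), (N <= #|A|)%N ->
    (exists2 S : {set G}, #|S| = m & {in S &, forall x y, x != y -> adj x y})
    \/ (exists2 S : {set G}, #|S| = n
          & {in S &, forall x y, x != y -> ~~ adj x y}).
Proof.
suff [N HN] : exists N : nat,
  forall (G : sgraph) (A : {set G}), (N <= #|A|)%N ->
    (exists S : {set G}, [/\ S \subset A, #|S| = m
       & {in S &, forall x y, x != y -> adj x y}])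
    \/ (exists S : {set G}, [/\ S \subset A, #|S| = n
          & {in S &, forall x y, x != y -> ~~ adj x y}]).
  exists N => G A /HN [] [S [_ cS eS]]; [left | right]; by exists S.
elim: m n => [|m IHm] n.
  exists 0%N => G A _; left; exists set0; rewrite sub0set cards0.
  by split=> // x y; rewrite inE.
elim: n => [|n [N2 H2]].
  exists 0%N => G A _; right; exists set0; rewrite sub0set cards0.
  by split=> // x y; rewrite inE.
have [N1 H1] := IHm n.+1.
exists (N1 + N2).+1 => G A leA.
have /card_gt0P [v vA] : (0 < #|A|)%N by exact: leq_trans leA.
pose B := [set y in A :\ v | adj v y]; pose C := [set y in A :\ v | ~~ adj v y].
have sBA : B \subset A by apply/subsetP=> y; rewrite !inE; case/andP => /andP[].
have sCA : C \subset A by apply/subsetP=> y; rewrite !inE; case/andP => /andP[].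
have cBC : (#|B| + #|C|)%N = #|A :\ v|.
  rewrite -(cardsID [set y | adj v y] (A :\ v)).
  congr (_ + _)%N; apply: eq_card => y; rewrite !inE //.
  by rewrite andbC.
have leBC : (N1 + N2 <= #|B| + #|C|)%N.
  by move: leA; rewrite (cardsD1 v A) vA cBC.
have [leB|ltB] := leqP N1 #|B|.
- have [[S [sS cS eS]]|[S [sS cS eS]]] := H1 G B leB; last first.
    by right; exists S; split=> //; exact: subset_trans sBA.
  left; exists (v |: S); split.
  + by rewrite subUset sub1set vA (subset_trans sS).
  + rewrite cardsU1 cS; case: (boolP (v \in S)) => // /(subsetP sS).
    by rewrite !inE eqxx.
  + move=> x y /setU1P [->|xS] /setU1P [->|yS] nxy.
    * by rewrite eqxx in nxy.
    * by move/(subsetP sS): yS; rewrite !inE => /andP[].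
    * by rewrite adj_sym; move/(subsetP sS): xS; rewrite !inE => /andP[].
    * exact: eS.
- have leC : (N2 <= #|C|)%N.
    rewrite leqNgt; apply/negP => ltC.
    move: leBC; rewrite leqNgt => /negP; apply.
    by rewrite -addSn leq_add // ltnW.
  have [[S [sS cS eS]]|[S [sS cS eS]]] := H2 G C leC.
    by left; exists S; split=> //; exact: subset_trans sCA.
  right; exists (v |: S); split.
  + by rewrite subUset sub1set vA (subset_trans sS).
  + rewrite cardsU1 cS; case: (boolP (v \in S)) => // /(subsetP sS).
    by rewrite !inE eqxx.
  + move=> x y /setU1P [->|xS] /setU1P [->|yS] nxy.
    * by rewrite eqxx in nxy.
    * by move/(subsetP sS): yS; rewrite !inE => /andP[].
    * by rewrite adj_sym; move/(subsetP sS): xS; rewrite !inE => /andP[].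
    * exact: eS.
Qed.

Lemma contains_clique (G H : sgraph) (S : {set G}) :
  #|S| = #|H| -> {in S &, forall x y, x != y -> adj x y} -> contains G H.
Proof.
move=> cS eS; pose f (x : H) := enum_val (cast_ord (esym cS) (enum_rank x)).
have fI : injective f.
  by move=> x y /enum_val_inj /cast_ord_inj /enum_rank_inj.
exists f => // x y xy; apply: eS; rewrite ?enum_valP //.
by apply: contraTneq xy => /fI ->; rewrite adj_irrefl.
Qed.

Lemma ramsey_exists (H1 H2 : sgraph) : exists N, `[< ramsey_prop H1 H2 N >].
Proof.
have [N HN] := ramsey_sets #|H1| #|H2|.
exists N; apply/asboolP => G cG.
have [|[S cS eS]|[S cS eS]] := HN G setT; first by rewrite cardsT cG.
- by left; exact: contains_clique eS.
- right; apply: (@contains_clique (complement G) H2 S) => // x y xS yS nxy.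
  by rewrite /= /compl_adj nxy eS.
Qed.

Definition ramsey (H1 H2 : sgraph) : nat := ex_minn (ramsey_exists H1 H2).

Definition C4_adj : rel 'Z_4 := fun x y => (y == x + 1) || (x == y + 1).

Lemma C4_adj_sym : symmetric C4_adj.
Proof. by move=> x y; rewrite /C4_adj orbC. Qed.

Lemma C4_adj_irrefl : irreflexive C4_adj.
Proof. by move=> x; rewrite /C4_adj orbb addrC -subr_eq subrr. Qed.

Definition C4 : sgraph := SGraph C4_adj_sym C4_adj_irrefl.

(* 'I_k is the common K_k; each of the n vertices of 'I_n completes it to one
   of the copies of K_{k+1}. *)
Definition book_adj (k n : nat) : rel ('I_k + 'I_n)%type := fun x y =>
  match x, y with
  | inl i, inl j => i != j
  | inr _, inr _ => false
  | _, _ => true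
  end.

Lemma book_adj_sym (k n : nat) : symmetric (@book_adj k n).
Proof. by move=> [i|i] [j|j] //=; rewrite eq_sym. Qed.

Lemma book_adj_irrefl (k n : nat) : irreflexive (@book_adj k n).
Proof. by move=> [i|i] //=; rewrite eqxx. Qed.

Definition book (k n : nat) : sgraph :=
  SGraph (@book_adj_sym k n) (@book_adj_irrefl k n).

Definition Qbound (R : realType) (k : nat) (eps : R) : R :=
  (320%:R * k%:R ^+ 4) ^+ k.+1 / eps ^+ (2 * k)%N.

(* The subtraction is exact when k >= 3. *)
Definition a_ (k : nat) : nat := ('C(k, 2) - k)%N.

(* Main.v *)
(** In a C4-free graph on N = q^2 + t vertices two distinct vertices have at most
    one common neighbour, so the sum of d(v)(d(v) - 1), plus the number M of
    ordered pairs without a common neighbour, is at most N(N - 1). It suffices to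
    find an independent k-set S with at most kq - C(k,2) neighbours: the vertices
    outside S and its neighbourhood are the pages of the book.

    If 2k^2 vertices have degree at most q - k, k independent ones among them will
    do. Otherwise the counting inequality, with p = q - t >= eps q, shows that at
    least pq/8k vertices have degree in (q - k, q], that M is O(k q^3), and that
    every degree is O(sqrt(k q^3)). Then S is chosen greedily among the vertices of
    degree at most q lying in few of the M pairs: each new vertex is nonadjacent
    to the previous ones and meets the neighbourhood of each of them, in pairwise
    distinct vertices. *)

Require Import Defs.
From mathcomp Require Import all_boot all_order all_algebra.
From mathcomp Require Import reals boolp zify ring lra.

Set Implicit Arguments.
Unset Strict Implicit.
Unset Printing Implicit Defensive.

Import Order.TTheory GRing.Theory Num.Theory.

(** * Unions and greedy choice in finite sets *)

Lemma leq_card_bigcup (I T : finType) (S : {set I}) (F : I -> {set T}) (m : nat) :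
  {in S, forall i, #|F i| <= m} -> #|\bigcup_(i in S) F i| <= #|S| * m.
Proof.
move=> leF; rewrite -sum_nat_const; apply: (@leq_trans (\sum_(i in S) #|F i|)).
  elim/big_rec2: _ => [|i n U _ leU]; first by rewrite cards0.
  by rewrite (leq_trans (leq_card_setU _ _)) // leq_add2l.
exact: leq_sum.
Qed.

Lemma greedy_subset (T : finType) (A : {set T}) (P : {set T} -> Prop) (k : nat) :
    P set0 ->
    (forall S : {set T}, S \subset A -> #|S| < k -> P S ->
       exists2 v, v \in A :\: S & P (v |: S)) ->
  exists S : {set T}, [/\ S \subset A, #|S| = k & P S].
Proof.
move=> P0 Pstep; suff /(_ k) : forall i, i <= k ->
    exists S : {set T}, [/\ S \subset A, #|S| = i & P S] by exact.
elim=> [|i IHi] lik; first by exists set0; rewrite sub0set cards0.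
have [S [sSA cS PS]] := IHi (ltnW lik).
have [|v /setDP[vA vS] PvS] := Pstep S sSA _ PS; first by rewrite cS.
by exists (v |: S); rewrite subUset sub1set vA sSA cardsU1 vS cS.
Qed.

Lemma setD_card_witness (T : finType) (A B : {set T}) :
  #|B| < #|A| -> exists2 v, v \in A & v \notin B.
Proof.
move=> ltBA; have /card_gt0P[v /setDP[]] : 0 < #|A :\: B|; last by exists v.
by have := subset_leq_card (subsetIr A B); rewrite -(cardsID B A) in ltBA *; lia.
Qed.

(** * Neighbourhoods in C4-free graphs *)

Definition nbhd (G : sgraph) (u : G) : {set G} := [set v | adj u v].

Definition nbhds (G : sgraph) (S : {set G}) : {set G} := \bigcup_(u in S) nbhd u.

Definition independent (G : sgraph) (S : {set G}) : Prop :=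
  {in S &, forall x y, ~~ adj x y}.

Definition C4_free (G : sgraph) : Prop :=
  forall u v : G, u != v -> #|nbhd u :&: nbhd v| <= 1.

Definition unlinked (G : sgraph) (u : G) : {set G} :=
  [set v | (v != u) && (nbhd u :&: nbhd v == set0)].

Lemma in_nbhd (G : sgraph) (u v : G) : (v \in nbhd u) = adj u v.
Proof. by rewrite inE. Qed.

Lemma contains_C4_or_C4_free (G : sgraph) : contains G C4 \/ C4_free G.
Proof.
have [C4G|nC4G] := pselect (contains G C4); [by left | right => u v neq_uv].
rewrite leqNgt; apply/negP => /card_gt1P[x [y [/setIP[ux vx] /setIP[uy vy] neq_xy]]].
apply: nC4G; rewrite !in_nbhd in ux uy vx vy.
pose f (i : 'Z_4) := nth u [:: u; x; v; y] i.
have xv : x != v by apply: contraTneq vx => ->; rewrite adj_irrefl.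
have xu : x != u by apply: contraTneq ux => ->; rewrite adj_irrefl.
have yv : y != v by apply: contraTneq vy => ->; rewrite adj_irrefl.
have yu : y != u by apply: contraTneq uy => ->; rewrite adj_irrefl.
exists f.
  move=> i j /eqP; rewrite /f nth_uniq //; last 1 first.
  - by rewrite /= !inE !negb_or neq_uv eq_sym xu eq_sym yu xv neq_xy eq_sym yv.
  - by move/eqP/val_inj.
case=> [[|[|[|[|//]]]] ?] [[|[|[|[|//]]]] ?] //=; rewrite /f /= => _;
  by rewrite ?ux ?uy ?vx ?vy // adj_sym ?ux ?uy ?vx ?vy.
Qed.

Lemma independentU1 (G : sgraph) (S : {set G}) (v : G) :
  independent S -> v \notin nbhds S -> independent (v |: S).
Proof.
move=> indS vS; have nadj u : u \in S -> ~~ adj u v.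
  by move=> uS; apply: contra vS => uv; apply/bigcupP; exists u; rewrite ?in_nbhd.
move=> x y /setU1P[->|xS] /setU1P[->|yS]; first by rewrite adj_irrefl.
- by rewrite adj_sym nadj.
- exact: nadj.
- exact: indS.
Qed.

(** Each chosen vertex rules out only itself and at most [D] others of [A], so a choice remains
    until [k] vertices are taken. *)
Lemma independent_bounded_degree (G : sgraph) (A : {set G}) (D k : nat) :
    {in A, forall v, #|nbhd v :&: A| <= D} -> k * D.+1 <= #|A| ->
  exists S : {set G}, [/\ S \subset A, #|S| = k & independent S].
Proof.
move=> degA leA; apply: greedy_subset => [x y|S sSA cS indS]; first by rewrite inE.
have [|v vA vF] := @setD_card_witness _ A (\bigcup_(u in S) (u |: nbhd u :&: A)).
  apply: (@leq_ltn_trans (#|S| * D.+1)); last by nia.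
  apply: leq_card_bigcup => u /(subsetP sSA) /degA degu.
  by rewrite cardsU1 -add1n leq_add // leq_b1.
exists v.
  rewrite inE vA andbT; apply: contra vF => vS; apply/bigcupP; exists v => //.
  by rewrite !inE eqxx.
apply: independentU1 => //; apply: contra vF => /bigcupP[u uS uv].
by apply/bigcupP; exists u => //; rewrite !inE vA andbT -in_nbhd uv orbT.
Qed.

(* Inside a neighbourhood a C4-free graph has maximum degree at most 1, so a
   vertex with 2k neighbours in A already provides k independent ones. *)
Lemma C4_free_independent (G : sgraph) (A : {set G}) (k : nat) :
    C4_free G -> 2 * k ^ 2 <= #|A| ->
  exists S : {set G}, [/\ S \subset A, #|S| = k & independent S].
Proof.
move=> C4G leA; case: (boolP [exists v in A, 2 * k <= #|nbhd v :&: A|]).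
  case/exists_inP=> v vA degv.
  have [||S [sS cS indS]] := @independent_bounded_degree G (nbhd v :&: A) 1 k.
  - move=> u /setIP[vu _]; rewrite (leq_trans _ (C4G u v _)) //.
      by rewrite subset_leq_card // setIS // subsetIl.
    by apply: contraTneq vu => ->; rewrite in_nbhd adj_irrefl.
  - by rewrite mulnC.
  by exists S; split=> //; exact: subset_trans sS (subsetIr _ _).
rewrite negb_exists_in => /forall_inP degA.
have [->|k_gt0] := posnP k.
  by exists set0; split; rewrite ?sub0set ?cards0 // => x y; rewrite inE.
apply: (@independent_bounded_degree G A (2 * k).-1) => [v /degA|]; first by lia.
by rewrite prednK; nia.
Qed.

(** Paths u-w-v with distinct ends, counted by their middle vertex w, give the first sum. An ordered
    pair (u, v) carries at most one such path, and an unlinked pair none, so each pair contributes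
    at most 1 to the left side. *)
Lemma sum_degree_unlinked (G : sgraph) : C4_free G ->
  \sum_(v : G) #|nbhd v| * (#|nbhd v| - 1) + \sum_(v : G) #|unlinked v|
    <= #|G| * (#|G| - 1).
Proof.
move=> C4G.
have -> : \sum_(v : G) #|nbhd v| * (#|nbhd v| - 1)
    = \sum_(u : G) \sum_(v | v != u) #|nbhd u :&: nbhd v|.
  under [RHS]eq_bigr => u _.
    under eq_bigr => v _ do rewrite -sum1_card big_mkcond.
    rewrite exchange_big; over.
  rewrite exchange_big; apply: eq_bigr => w _ /=.
  rewrite -sum_nat_const big_mkcond /=; apply: eq_bigr => u _.
  rewrite in_nbhd adj_sym; case: (boolP (adj u w)) => uw; last first.
    by rewrite big1 // => v _; rewrite !inE (negbTE uw).
  rewrite -big_mkcondr /= sum1_card (cardsD1 u (nbhd w)) in_nbhd adj_sym uw addKn.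
  by apply: eq_card => v; rewrite !inE unfold_in /= !inE uw adj_sym.
rewrite -big_split /= -sum_nat_const; apply: leq_sum => u _.
have -> : #|G| - 1 = \sum_(v | v != u) 1 by rewrite sum1_card cardC1 subn1.
have -> : #|unlinked u| = \sum_(v | v != u) (nbhd u :&: nbhd v == set0).
  rewrite -sum1_card big_mkcond [RHS]big_mkcond; apply: eq_bigr => v _.
  by rewrite inE; case: (v != u) => //=; case: eqP.
rewrite -big_split; apply: leq_sum => v vu /=.
case: eqP => [->|_]; first by rewrite cards0.
by rewrite addn0 C4G // eq_sym.
Qed.

Definition common_nbhds (G : sgraph) (S : {set G}) : {set G} :=
  \bigcup_(u in S) \bigcup_(u' in S :\ u) (nbhd u :&: nbhd u').

Lemma leq_card_common_nbhds (G : sgraph) (S : {set G}) : C4_free G ->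
  #|common_nbhds S| <= #|S| * #|S|.
Proof.
move=> C4G; apply: leq_card_bigcup => u uS.
apply: (@leq_trans (#|S :\ u| * 1)); last by rewrite muln1 subset_leq_card ?subD1set.
by apply: leq_card_bigcup => u' /setD1P[neq _]; apply: C4G; rewrite eq_sym.
Qed.

(* Distinct vertices of S are linked to v through distinct neighbours, because v
   avoids the neighbourhoods of the vertices with two neighbours in S. *)
Lemma leq_card_nbhdI (G : sgraph) (S : {set G}) (v : G) :
    v \notin S -> v \notin \bigcup_(u in S) unlinked u ->
    v \notin nbhds (common_nbhds S) ->
  #|S| <= #|nbhd v :&: nbhds S|.
Proof.
move=> vS vU vC; pose c u := odflt u [pick w in nbhd u :&: nbhd v].
have cP u : u \in S -> c u \in nbhd u :&: nbhd v.
  move=> uS; rewrite /c; case: pickP => [w //|uv0]; case/negP: vU.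
  apply/bigcupP; exists u => //; rewrite inE eq_sym (memPn vS) //=.
  by apply/eqP/setP=> w; rewrite uv0 in_set0.
have c_inj : {in S &, injective c}.
  move=> u u' uS u'S eq_c; apply/eqP/negPn/negP => neq; case/negP: vC.
  have /setIP[cu cv] := cP u uS; have /setIP[cu' _] := cP u' u'S.
  apply/bigcupP; exists (c u); last by rewrite in_nbhd adj_sym -in_nbhd.
  apply/bigcupP; exists u => //; apply/bigcupP; exists u'.
    by rewrite !inE eq_sym neq.
  by rewrite inE cu eq_c.
rewrite -(card_in_imset c_inj) subset_leq_card //.
apply/subsetP=> _ /imsetP[u uS ->]; have /setIP[cu cv] := cP u uS.
by rewrite inE cv; apply/bigcupP; exists u.
Qed.

(** A chosen vertex forbids itself, its [q] neighbours and its [m] unlinked partners; the at most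
    |S|^2 common neighbours forbid [D] vertices each, which is at most [k * D] per chosen vertex. *)
Lemma greedy_sparse_independent (G : sgraph) (A : {set G}) (q k m D : nat) :
    C4_free G -> 0 < k ->
    {in A, forall v, #|nbhd v| <= q} -> {in A, forall v, #|unlinked v| <= m} ->
    (forall w : G, #|nbhd w| <= D) -> k * (1 + q + m + k * D) <= #|A| ->
  exists S : {set G},
    [/\ #|S| = k, independent S & #|nbhds S| + 'C(k, 2) <= k * q].
Proof.
move=> C4G k_gt0 degA unlA degG leA.
pose P (S : {set G}) := independent S /\ #|nbhds S| + 'C(#|S|, 2) <= #|S| * q.
suff [S [_ cS [indS leS]]] :
    exists S : {set G}, [/\ S \subset A, #|S| = k & P S].
  by exists S; rewrite -cS.
apply: greedy_subset => [|S sSA ltSk [indS leS]].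
  split; first by move=> x y; rewrite inE.
  by rewrite /nbhds big_set0 cards0.
have [|v vA] := @setD_card_witness _ A
    (S :|: nbhds S :|: \bigcup_(u in S) unlinked u :|: nbhds (common_nbhds S)).
  apply: leq_ltn_trans (leq_card_setU _ _) _.
  have leU : #|\bigcup_(u in S) unlinked u| <= #|S| * m.
    by apply: leq_card_bigcup => u /(subsetP sSA) /unlA.
  have leC : #|nbhds (common_nbhds S)| <= #|S| * #|S| * D.
    apply: (@leq_trans (#|common_nbhds S| * D)).
      by apply: leq_card_bigcup => w _.
    by rewrite leq_mul2r leq_card_common_nbhds ?orbT.
  have [] := leq_card_setU (S :|: nbhds S) (\bigcup_(u in S) unlinked u).
  have [] := leq_card_setU S (nbhds S).
  have : #|S| * #|S| * D <= #|S| * (k * D) by rewrite -mulnA; nia.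
  have : #|S|.+1 * (1 + q + m + k * D) <= #|A|.
    by apply: leq_trans leA; rewrite leq_mul2r ltSk orbT.
  by rewrite mulSn !mulnDr; lia.
rewrite !in_setU !negb_or => /andP[/andP[/andP[vS vN] vU] vC].
exists v; first by rewrite inE vS.
split; first exact: independentU1.
have leI := leq_card_nbhdI vS vU vC.
have degv := degA v vA.
(* The overlap of at least |S| neighbours pays for the increment C(|S|+1, 2) - C(|S|, 2) = |S|. *)
rewrite cardsU1 vS /nbhds bigcup_setU big_set1 -/(nbhds S) add1n binS bin1.
by have := cardsUI (nbhd v) (nbhds S); lia.
Qed.

(** * Degree counting *)

Lemma sum_nat_mem (T : finType) (A : {set T}) (c : nat) :
  \sum_(v : T) c * (v \in A) = c * #|A|.
Proof. by rewrite -big_distrr -sum1_card [in RHS]big_mkcond /=. Qed.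

Section DegreeClasses.

Variables (G : sgraph) (k q p : nat).
Hypotheses (C4G : C4_free G) (cG : #|G| + p = q ^ 2 + q).
Hypotheses (lepq : p <= q) (q_gt0 : 0 < q).

Let B : {set G} := [set v | #|nbhd v| + k <= q].
Let A : {set G} := [set v | (q < #|nbhd v| + k) && (#|nbhd v| <= q)].

(** Compare d(d-1) with q^2 + q = n + p, where n = [#|G|]. The total deficit is at least np, since
    the sum of d(d-1) is at most n(n-1). Degrees above q have no deficit, those in [A] at most
    2q(k+1), those in [B] at most 2q(q+1). *)
Lemma middle_degree_lower_bound :
  #|G| * p <= 2 * q * (k.+1 * #|A| + q.+1 * #|B|).
Proof.
have lesum : #|G| * (q ^ 2 + q) <=
    \sum_(v : G) #|nbhd v| * (#|nbhd v| - 1)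
      + 2 * q * k.+1 * #|A| + 2 * q * q.+1 * #|B|.
  rewrite -!sum_nat_mem -sum_nat_const -!big_split; apply: leq_sum => v _; rewrite !inE.
  case: (leqP (#|nbhd v| + k) q) => [_|ltq] /=; first by nia.
  by case: (leqP #|nbhd v| q) => [leq|gtq] /=; nia.
rewrite -cG mulnDr in lesum.
by have := sum_degree_unlinked C4G; rewrite mulnBr mulnDr !mulnA; lia.
Qed.

(* The subtraction is truncated: only degrees above q contribute to the first
   sum. *)
Lemma excess_unlinked_upper_bound :
  \sum_(v : G) (#|nbhd v| - q) ^ 2 + \sum_(v : G) #|unlinked v|
    <= 2 * q * (#|G| + k * #|A| + q * #|B|).
Proof.
(* For d > q, d(d-1) - q(q-1) = (d-q)(d+q-1) is at least (d-q)^2; the terms in [A] and [B] cover the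
   deficits of the other degrees. *)
have lesum : \sum_(v : G) (#|nbhd v| - q) ^ 2 + #|G| * (q ^ 2 - q) <=
    \sum_(v : G) #|nbhd v| * (#|nbhd v| - 1)
      + 2 * q * k * #|A| + 2 * q * q * #|B|.
  rewrite -!sum_nat_mem -sum_nat_const -!big_split; apply: leq_sum => v _; rewrite !inE.
  case: (leqP (#|nbhd v| + k) q) => [_|ltq] /=; first by nia.
  by case: (leqP #|nbhd v| q) => [leq|gtq] /=; nia.
rewrite mulnBr in lesum.
have leG : #|G| * #|G| <= #|G| * (q ^ 2 + q) by rewrite leq_mul2l; lia.
rewrite mulnDr in leG.
by have := sum_degree_unlinked C4G; rewrite mulnBr !mulnDr !mulnA; lia.
Qed.

End DegreeClasses.

(** * Sparse independent sets *)

(** Turns a lower bound of order q^(1/2) on p into one of order q^(3/2) on a; squaring avoids the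
    roots. *)
Lemma leq_sqr_cancel (u c q p a : nat) :
  0 < u -> q * p <= u * a -> (u * c) ^ 2 * q <= p ^ 2 -> c ^ 2 * q ^ 3 <= a ^ 2.
Proof.
have -> : c ^ 2 * q ^ 3 = q ^ 2 * (c ^ 2 * q) by lia.
move=> u_gt0 leqp lep; have u2_gt0 : 0 < u ^ 2 by rewrite expn_gt0 u_gt0.
rewrite -(leq_pmul2l u2_gt0) -[leqRHS]expnMn.
apply: (@leq_trans ((q * p) ^ 2)); last by rewrite leq_exp2r.
rewrite mulnCA [leqRHS]expnMn [u ^ 2 * _]mulnA -expnMn.
by rewrite leq_mul2l lep orbT.
Qed.

Lemma leq_of_sqr_mul (c p q : nat) :
  p <= q -> 0 < q -> c ^ 2 * q <= p ^ 2 -> c <= p.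
Proof.
move=> lepq q_gt0 lep; have [->//|c_gt0] := posnP c.
rewrite (leq_trans (leq_pmulr c c_gt0)) // -(leq_pmul2r q_gt0).
by apply: leq_trans lep _; rewrite -mulnn leq_mul2l lepq orbT.
Qed.

(* n, a and b stand for #|G| and for the sizes of the sets A and B of the section
   above. *)
Section DegreeArithmetic.

Variables k q p n a b c : nat.
Hypotheses (k_gt1 : 1 < k) (p_gt0 : 0 < p) (lepq : p <= q).
Hypotheses (c_eq : c = 320 * k ^ 4) (lep : c ^ 2 * q <= p ^ 2).
Hypotheses (n_eq : n + p = q ^ 2 + q) (ltb : b < 2 * k ^ 2).
Hypothesis low_a : n * p <= 2 * q * (k.+1 * a + q.+1 * b).

Lemma p_lower_bound : 320 * k ^ 4 <= p.
Proof. by rewrite -c_eq (leq_of_sqr_mul lepq) // (leq_trans p_gt0). Qed.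

(** As p >= 32k^2 and b < 2k^2, the [b] term of [low_a] takes at most half of q^2 p, and n >= q^2;
    the rest uses k + 1 <= 2k. *)
Lemma a_lower_bound : q * p <= 8 * k * a.
Proof.
have lepk : 32 * k ^ 2 <= p.
  by apply: leq_trans p_lower_bound; rewrite leq_mul // leq_exp2l.
have leb : 2 * (2 * q * (q.+1 * b)) <= q * (q * p).
  have : q * (q.+1 * b) <= q * (2 * q * (2 * k ^ 2)).
    by rewrite leq_mul2l leq_mul ?orbT //; lia.
  have : q * (q * (32 * k ^ 2)) <= q * (q * p) by rewrite !leq_mul2l lepk !orbT.
  by lia.
have len : q ^ 2 * p <= n * p by rewrite leq_mul2r; lia.
have : q * (q * p) <= q * (8 * k * a).
  have : q * a <= q * a * k by rewrite leq_pmulr; lia.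
  by move: len low_a leb; rewrite mulnDr -mulnn; lia.
by rewrite leq_pmul2l; lia.
Qed.

(** The constant 40k^3 is 320k^4 divided by the 8k of [a_lower_bound]. *)
Lemma a_linear_bound : 40 * k ^ 3 * q <= a.
Proof.
have : 8 * k * (40 * k ^ 3 * q) <= 8 * k * a.
  apply: leq_trans a_lower_bound.
  have : q * (320 * k ^ 4) <= q * p by rewrite leq_mul2l p_lower_bound orbT.
  by lia.
by rewrite leq_pmul2l; lia.
Qed.

Lemma a_square_bound : (40 * k ^ 3) ^ 2 * q ^ 3 <= a ^ 2.
Proof.
have k8_gt0 : 0 < 8 * k by lia.
have k4 : 320 * k ^ 4 = 8 * k * (40 * k ^ 3) by lia.
by apply: (leq_sqr_cancel k8_gt0 a_lower_bound); rewrite -k4 -c_eq.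
Qed.

Lemma excess_cubic_bound : a <= n ->
  2 * q * (n + k * a + q * b) <= 8 * k * q ^ 3.
Proof.
move=> lean.
have leqq : q <= q ^ 2 by rewrite -mulnn leq_pmulr; lia.
have lepk : 2 * k ^ 2 <= p.
  by apply: leq_trans p_lower_bound; rewrite leq_mul // leq_exp2l.
have leka : k * a <= k * (2 * q ^ 2) by rewrite leq_mul2l; lia.
have leqb : q * b <= q ^ 2 by rewrite -mulnn leq_mul2l; lia.
have lek : 2 * q ^ 2 <= k * q ^ 2 by rewrite leq_mul2r; lia.
have : 2 * q * (n + k * a + q * b) <= 2 * q * (4 * k * q ^ 2).
  by rewrite leq_mul2l; lia.
by lia.
Qed.

(** Split d into q and its excess over q: the linear bound on a controls the first, the square bound
    the second, each with half of a. *)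
Lemma degree_bound (d : nat) : (d - q) ^ 2 <= 8 * k * q ^ 3 -> 8 * k ^ 2 * d <= a.
Proof.
move=> led.
have leq : 2 * (8 * k ^ 2 * q) <= a.
  apply: leq_trans a_linear_bound.
  have : 2 * (k ^ 2 * q) <= k * (k ^ 2 * q) by rewrite leq_mul2r; lia.
  by lia.
have : 2 * (8 * k ^ 2 * (d - q)) <= a.
  rewrite -(@leq_exp2r _ _ 2) //; apply: leq_trans a_square_bound.
  have : k ^ 4 * (d - q) ^ 2 <= k ^ 4 * (8 * k * q ^ 3).
    by rewrite leq_mul2l led orbT.
  have : 2 * (k ^ 5 * q ^ 3) <= k * (k ^ 5 * q ^ 3) by rewrite leq_mul2r; lia.
  by rewrite !expnMn; lia.
have : 8 * k ^ 2 * d <= 8 * k ^ 2 * q + 8 * k ^ 2 * (d - q).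
  by rewrite -mulnDr leq_mul2l; lia.
by lia.
Qed.

(** Here d will count the vertices of [A] lying in too many unlinked pairs: they are at most half of
    [A]. *)
Lemma exceptional_bound (d : nat) : d * a <= 8 * k * (8 * k * q ^ 3) -> 2 * d <= a.
Proof.
move=> led.
have a_gt0 : 0 < a.
  by apply: leq_trans a_linear_bound; rewrite !muln_gt0; lia.
rewrite -(leq_pmul2r a_gt0) mulnn; apply: leq_trans a_square_bound.
have : k ^ 2 * q ^ 3 <= k ^ 6 * q ^ 3 by rewrite leq_mul2r leq_exp2l ?orbT.
by lia.
Qed.

(** The parts k(1 + q), kx and k^2 y are at most a/4, a/8 and a/8. *)
Lemma greedy_bound (x y : nat) : 8 * k * x <= a -> 8 * k ^ 2 * y <= a ->
  2 * (k * (1 + q + x + k * y)) <= a.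
Proof.
move=> lex ley.
have : 4 * (k * (1 + q)) <= a.
  apply: leq_trans a_linear_bound.
  have : k * q <= k ^ 3 * q by rewrite leq_mul2r -{1}(expn1 k) leq_exp2l ?orbT.
  have : k * (1 + q) <= k * (2 * q) by rewrite leq_mul2l; lia.
  by lia.
by lia.
Qed.

End DegreeArithmetic.

Lemma C4_free_sparse_independent (G : sgraph) (k q p : nat) :
    C4_free G -> 1 < k -> #|G| + p = q ^ 2 + q -> 0 < p <= q ->
    (320 * k ^ 4) ^ 2 * q <= p ^ 2 ->
  exists S : {set G},
    [/\ #|S| = k, independent S & #|nbhds S| + 'C(k, 2) <= k * q].
Proof.
move=> C4G k_gt1 cG /andP[p_gt0 lepq] lep.
pose B : {set G} := [set v | #|nbhd v| + k <= q].
pose A : {set G} := [set v | (q < #|nbhd v| + k) && (#|nbhd v| <= q)].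
have [leB|ltB] := leqP (2 * k ^ 2) #|B|.
  have [S [sSB cS indS]] := C4_free_independent C4G leB.
  exists S; split=> //.
  have : #|nbhds S| <= k * (q - k).
    rewrite -cS; apply: leq_card_bigcup => u /(subsetP sSB); rewrite inE cS; lia.
  have : 'C(k, 2) <= k * k by rewrite bin2; nia.
  (* Makes the truncated q - k exact, so that k(q - k) + C(k, 2) <= kq. *)
  have : k <= q.
    have : S != set0 by rewrite -card_gt0 cS; lia.
    by case/set0Pn=> u /(subsetP sSB); rewrite inE; lia.
  by nia.
have q_gt0 : 0 < q by lia.
have lowA := middle_degree_lower_bound k C4G cG lepq q_gt0.
have upT := excess_unlinked_upper_bound k C4G cG lepq q_gt0.
rewrite -/A -/B in lowA upT.
set a := #|A| in lowA upT *; set b := #|B| in ltB lowA upT *.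
set n := #|G| in cG lowA upT.
have lean : a <= n by exact: max_card.
have leT := leq_trans upT
  (excess_cubic_bound k_gt1 p_gt0 lepq erefl lep cG ltB lowA lean).
have degG (w : G) : 8 * k ^ 2 * #|nbhd w| <= a.
  apply: (degree_bound k_gt1 p_gt0 lepq erefl lep cG ltB lowA).
  by apply: leq_trans leT; rewrite (bigD1 w) //= -addnA leq_addr.
(* By Markov's inequality, discarding vertices with more than a/(8k) unlinked partners keeps at
   least half of [A]. *)
pose A' := [set v in A | 8 * k * #|unlinked v| <= a].
have leA' : a <= 2 * #|A'|.
  have leD : #|A :\: A'| * a <= 8 * k * (8 * k * q ^ 3).
    apply: (@leq_trans (8 * k * \sum_(v : G) #|unlinked v|)); last first.
      by rewrite leq_mul2l (leq_trans (leq_addl _ _) leT) orbT.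
    rewrite -sum_nat_const big_mkcond big_distrr; apply: leq_sum => v _ /=.
    by case: ifP => //; rewrite !inE => /andP[]; case: (leqP (8 * k * _) a); lia.
  have := exceptional_bound k_gt1 p_gt0 lepq erefl lep cG ltB lowA leD.
  have := cardsID A' A; rewrite (setIidPr _) -/a; first by lia.
  by apply/subsetP=> v; rewrite inE => /andP[].
apply: (@greedy_sparse_independent G A' q k (a %/ (8 * k)) (a %/ (8 * k ^ 2))).
- exact: C4G.
- exact: ltnW.
- by move=> v; rewrite !inE => /andP[/andP[_ ->]].
- move=> v; rewrite inE => /andP[_ leu].
  by rewrite leq_divRL ?muln_gt0 ?[0 < k]ltnW // mulnC.
- by move=> w; rewrite leq_divRL ?muln_gt0 ?expn_gt0 ?[0 < k]ltnW // mulnC.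
have := @greedy_bound _ _ _ _ _ _ _ k_gt1 p_gt0 lepq erefl lep cG ltB lowA
          (a %/ (8 * k)) (a %/ (8 * k ^ 2)).
rewrite [8 * k * _]mulnC [8 * k ^ 2 * _]mulnC !leq_trunc_div => /(_ isT isT) le_a.
by rewrite -(@leq_pmul2l 2) // (leq_trans le_a).
Qed.

(** * Books in the complement and the Ramsey bound *)

Lemma nbhds_card_book (G : sgraph) (S : {set G}) (k n : nat) :
    #|S| = k -> independent S -> n + k + #|nbhds S| <= #|G| ->
  contains (complement G) (book k n).
Proof.
move=> cS indS leG; pose U : {set G} := ~: (S :|: nbhds S).
have leU : n <= #|U|.
  have := cardsC (S :|: nbhds S); have [] := leq_card_setU S (nbhds S).
  by rewrite -/U; lia.
pose f (x : 'I_k + 'I_n) : G := match x with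
  | inl i => enum_val (cast_ord (esym cS) i)
  | inr j => enum_val (widen_ord leU j) end.
have fS i : f (inl i) \in S by exact: enum_valP.
have fU j : f (inr j) \in U by exact: enum_valP.
have SU x y : x \in S -> y \in U -> (x != y) && ~~ adj x y.
  rewrite !inE negb_or => xS /andP[yS yN]; rewrite (memPn yS) //=.
  by apply: contra yN => xy; apply/bigcupP; exists x; rewrite ?in_nbhd.
have f_inj : injective f.
  move=> [i|i] [j|j] /=.
  - by move/enum_val_inj/cast_ord_inj=> ->.
  - by move=> eqf; have := SU _ _ (fS i) (fU j); rewrite /= eqf eqxx.
  - by move=> eqf; have := SU _ _ (fS j) (fU i); rewrite /= eqf eqxx.
  - by move/enum_val_inj/(congr1 val) => /= eqij; congr inr; apply: val_inj.
exists f => // -[i|i] [j|j] //= ij; last first.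
- by rewrite compl_adj_sym; exact: SU (fS j) (fU i).
- exact: SU (fS i) (fU j).
rewrite /compl_adj indS ?enum_valP // andbT.
by apply: contra ij => /eqP/enum_val_inj/cast_ord_inj ->.
Qed.

Local Open Scope ring_scope.

(* q >= Qbound k eps forces k * q <= q ^ 2, so the natural-number subtraction
   in the index of the book is exact. *)
Theorem theorem1p5 (R : realType) (k : nat) (eps : R) (q t : nat)
    (hk : (3 <= k)%N) (heps0 : 0 < eps) (heps1 : eps < 1)
    (hq : Qbound k eps <= q%:R) (ht : t%:R <= (1 - eps) * q%:R) :
  (ramsey C4 (book k (q ^ 2 - k * q + t + a_ k)) <= q ^ 2 + t)%N.
Proof.
(* With c = 320k^4 >= 1 and eps < 1, only c^2 is kept of c^(k+1) / eps^(2k-2). *)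
have Q0 : (320%:R * k%:R ^+ 4) ^+ 2 <= eps ^+ 2 * Qbound k eps.
  have ge1 : 1 <= 320%:R * k%:R ^+ 4 :> R.
    by rewrite -natrX -natrM ler1n muln_gt0 expn_gt0; lia.
  have -> : eps ^+ 2 * Qbound k eps
      = (320%:R * k%:R ^+ 4) ^+ k.+1 / eps ^+ (2 * k - 2).
    rewrite /Qbound -{1}(subnKC (_ : 2 <= 2 * k)%N); last by lia.
    rewrite exprD; field.
    by rewrite expf_neq0 ?lt0r_neq0.
  rewrite ler_pdivlMr ?exprn_gt0 //.
  apply: (@le_trans _ _ ((320%:R * k%:R ^+ 4) ^+ 2)).
    by rewrite ler_piMr ?exprn_ge0 ?(le_trans ler01) // exprn_ile1 // ltW.
  by rewrite ler_weXn2l //; lia.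
have le_tq : (t <= q)%N.
  rewrite -(ler_nat R) (le_trans ht) // -[leRHS]mul1r ler_wpM2r //.
  by lra.
pose p := (q - t)%N.
have le_p : eps * q%:R <= p%:R.
  by rewrite natrB //; lra.
(* p^2 >= eps^2 q^2 >= (eps^2 Q) q >= c^2 q. *)
have lep : ((320 * k ^ 4) ^ 2 * q <= p ^ 2)%N.
  rewrite -(ler_nat R) natrM !natrX natrM natrX.
  apply: (@le_trans _ _ ((eps * q%:R) ^+ 2)); last first.
    by rewrite lerXn2r // nnegrE ?mulr_ge0 // ltW.
  have -> : (eps * q%:R) ^+ 2 = eps ^+ 2 * q%:R * q%:R by ring.
  by rewrite ler_wpM2r // (le_trans Q0) // ler_wpM2l // exprn_ge0 // ltW.
rewrite /ramsey; case: ex_minnP => m _; apply; apply/asboolP => G cG.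
have [|C4G] := contains_C4_or_C4_free G; first by left.
right.
have q_gt0 : (0 < q)%N.
  rewrite -(ltr_nat R) (lt_le_trans _ hq) // divr_gt0 ?exprn_gt0 //.
  by rewrite mulr_gt0 ?exprn_gt0 // ltr0n; lia.
have p_gt0 : (0 < p)%N.
  by rewrite -(ltr_nat R) (lt_le_trans _ le_p) // mulr_gt0 // ltr0n.
have [||||S [cS indS leS]] := @C4_free_sparse_independent G k q p C4G.
- by lia.
- by rewrite cG /p; lia.
- by rewrite p_gt0 leq_subr.
- by [].
(* Pages, spine and neighbourhood add up to at most (q^2 - kq + t + C(k, 2) - k) + k + (kq - C(k,
   2)) = q^2 + t; the two inequalities below make the truncated subtractions exact. *)
apply: nbhds_card_book cS indS _; rewrite cG /a_.
have : (k <= 'C(k, 2))%N by rewrite bin2; nia.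
have : (k * q <= q ^ 2)%N.
  have := leq_of_sqr_mul (leq_subr t q) q_gt0 lep.
  have : (k ^ 1 <= k ^ 4)%N by rewrite leq_exp2l //; lia.
  by rewrite expn1 -mulnn leq_mul2r /p; lia.
by lia.
Qed.
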